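(* For every decreasing function $\eta:\mathbf{N}\to(0,1)$ there is some $M=M(\eta)\in\mathbf{N}$ such that for all finite abelian groups $A,B,C$ and every bilinear map $\phi:A\times B\to C$, the bilinear zero probability $\Pr(\phi)$ can be written in the form $\Pr(\phi)=q+\varepsilon$, where $\mathcal{E}(q)\leq M$ and $0\leq\varepsilon\leq\eta(\mathcal{E}(q))$.
   Context: For finite abelian groups $A,B,C$ and a bilinear (i.e. biadditive) map $\phi:A\times B\to C$, $\Pr(\phi)=\frac{1}{|A||B|}|\{(a,b)\in A\times B:\phi(a,b)=0\}|$. The Egyptian complexity $\mathcal{E}(q)$ of a rational number $q>0$ is the least positive integer $m$ such that $q=1/n_1+\cdots+1/n_m$ for some positive integers $n_1,\dots,n_m$ (not necessarily distinct); moreover $\mathcal{E}(0)=0$, and $\mathcal{E}(x)=\infty$ if $x$ is irrational. Here $q\geq 0$ is a real number (necessarily rational, since $\mathcal{E}(q)\le M<\infty$). $\mathbf{N}=\{0,1,2,\dots\}$. The integer $M$ depends only on $\eta$. *)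

(* Defs.v *)
From mathcomp Require Import all_boot all_order all_algebra.
From mathcomp Require Import boolp reals.

Set Implicit Arguments.
Unset Strict Implicit.
Unset Printing Implicit Defensive.

Import Order.TTheory GRing.Theory Num.Theory.
Local Open Scope ring_scope.

Definition biadditive (A B C : zmodType) (phi : A -> B -> C) : Prop :=
  (forall b, zmod_morphism (phi^~ b)) /\ (forall a, zmod_morphism (phi a)).

Definition zero_prob (R : realType) (A B C : finZmodType) (phi : A -> B -> C)
    : R :=
  #|[set p : A * B | phi p.1 p.2 == 0]|%:R / (#|A| * #|B|)%:R.

Definition egyptian_sum (R : realType) (q : R) (m : nat) : Prop :=
  exists n : 'I_m -> nat,
    (forall i, (0 < n i)%N) /\ q = \sum_(i < m) (n i)%:R^-1.

(* None stands for infinity.  The empty sum (m = 0) represents 0 and nothing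
   else, so the least m over all of nat is 0 at q = 0 and is the least positive
   m at q > 0.  Irrational (and negative) q have no representation. *)
Definition egyptian_complexity (R : realType) (q : R) : option nat :=
  match pselect (exists m, `[< egyptian_sum q m >]) with
  | left ex_m => Some (ex_minn ex_m)
  | right _ => None
  end.

Lemma egyptian_complexityP (R : realType) (q : R) (m : nat) :
  egyptian_complexity q = Some m <->
  egyptian_sum q m /\ forall k, egyptian_sum q k -> (m <= k)%N.
Proof.
rewrite /egyptian_complexity; case: pselect => [ex_m|no_m].
  case: ex_minnP => m0 /asboolP m0P m0_min; split=> [[<-]|[mP m_min]].
    by split=> // k kP; apply: m0_min; apply/asboolP.
  congr Some; apply/eqP; rewrite eqn_leq m_min // andbT.
  by apply: m0_min; apply/asboolP.
by split=> // -[mP _]; case: no_m; exists m; apply/asboolP.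
Qed.

(* Main.v *)
(* Pr(phi) is the average over a of 1 / |phi(a,B)|.  Either few a have a small
   image phi(a,B), and q = 0 works, or one finds a gap in the sizes: a subgroup
   H of A such that |phi(a,B)| is bounded for a in H and far larger for a
   outside H, where "far" is any prescribed function of the bound.  Doing the
   same for the maps phi(.,b) on H yields K <= B, and up to a tiny nonnegative
   error only H x K contributes.  There phi takes boundedly many values, and one
   finds D <= C such that {a in H : phi(a,K) <= D} has bounded index in H while
   phi(a,K) contains D for almost all a in H.  Replacing phi(a,K) by phi(a,K) + D
   makes the summand constant on boundedly many cosets, each of which contributes
   a unit fraction; this sum is q. *)

Require Import Defs.
From mathcomp Require Import all_boot all_order all_algebra all_fingroup.
From mathcomp Require Import boolp reals.
From mathcomp Require Import ring lra.

Set Implicit Arguments.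
Unset Strict Implicit.
Unset Printing Implicit Defensive.

Import Order.TTheory GRing.Theory Num.Theory.
Local Open Scope ring_scope.

(** * Image subgroups and gaps in their sizes *)

Lemma card_imset_ker (A C : finZmodType) (f : A -> C) (K : {group A}) :
  zmod_morphism f ->
  (#|f @: K| * #|[set x in K | f x == 0%R]|)%N = #|K|.
Proof.
move=> fB.
have f0 : f 0 = 0 by rewrite -[X in f X](subrr 0) fB subrr.
have fM : {in K &, {morph f : x y / (x * y)%g}}.
  move=> x y _ _; change (f (x + y) = f x + f y).
  by rewrite -{1}[y]opprK fB -[- y]sub0r fB f0 sub0r opprK.
pose g := Morphism fM.
have := card_morphim g K; rewrite setIid morphimEdom => ->.
have -> : [set x in K | f x == 0] = ('ker g)%g.
  by apply/setP => x; rewrite !inE.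
by rewrite mulnC Lagrange // subsetIl.
Qed.

Section ImageSubgroups.

Variables (A B C : finZmodType) (phi : A -> B -> C).
Hypothesis phiB : biadditive phi.

Let phi0l b : phi 0 b = 0.
Proof. by have [/(_ b 0 0) + _] := phiB; rewrite /= !subrr. Qed.

Let phiBl x y b : phi (x - y) b = phi x b - phi y b.
Proof. by have [/(_ b x y)] := phiB. Qed.

Let phiDl x y b : phi (x + y) b = phi x b + phi y b.
Proof. by rewrite -{1}[y]opprK phiBl -[- y]sub0r phiBl phi0l sub0r opprK. Qed.

Let phi0r a : phi a 0 = 0.
Proof. by have [_ /(_ a 0 0)] := phiB; rewrite !subrr. Qed.

Let phiDr a x y : phi a (x + y) = phi a x + phi a y.
Proof.
have [_ /(_ a) fB] := phiB.
by rewrite -{1}[y]opprK fB -[- y]sub0r fB phi0r sub0r opprK.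
Qed.

Definition img (K : {set B}) (a : A) : {set C} := [set phi a b | b in K].

Lemma img_group_set (K : {group B}) a : group_set (img K a).
Proof.
apply/group_setP; split; first by apply/imsetP; exists 0; rewrite ?phi0r ?group1.
move=> _ _ /imsetP[x Kx ->] /imsetP[y Ky ->].
by apply/imsetP; exists (x + y); rewrite ?phiDr //; apply: groupM.
Qed.

Definition img_group (K : {group B}) a : {group C} := Group (img_group_set K a).

Lemma card_img_gt0 (K : {group B}) a : (0 < #|img K a|)%N.
Proof. exact: (cardG_gt0 (img_group K a)). Qed.

Lemma card_img_ker (K : {group B}) a :
  (#|img K a| * #|[set b in K | phi a b == 0%R]|)%N = #|K|.
Proof. by apply: card_imset_ker; case: phiB. Qed.

Lemma img0 (K : {group B}) : img K 0 = [set 0].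
Proof.
apply/setP => c; rewrite inE; apply/imsetP/eqP => [[b _ ->]|->].
  exact: phi0l.
by exists 0; rewrite ?phi0l ?group1.
Qed.

Lemma img_add_sub (K : {group B}) x y : img K (x + y) \subset (img K x * img K y)%g.
Proof.
apply/subsetP => _ /imsetP[b Kb ->]; rewrite phiDl.
by apply: (@mem_mulg C); apply: imset_f.
Qed.

Lemma card_mulg_le (X Y : {set C}) : (#|(X * Y)%g| <= #|X| * #|Y|)%N.
Proof.
rewrite -cardsX -[(X * Y)%g]/[set (x * y)%g | x in X, y in Y].
by rewrite curry_imset2X leq_imset_card.
Qed.

Lemma card_img_add (K : {group B}) x y :
  (#|img K (x + y)%R| <= #|img K x| * #|img K y|)%N.
Proof. exact: leq_trans (subset_leq_card (img_add_sub K x y)) (card_mulg_le _ _). Qed.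

Lemma img_opp (K : {group B}) x : img K (- x) = img K x.
Proof.
suff sub y : img K (- y) \subset img K y.
  by apply/eqP; rewrite eqEsubset sub -{1}[x]opprK sub.
apply/subsetP => _ /imsetP[b Kb ->]; rewrite -[- y]sub0r phiBl phi0l sub0r.
exact: (groupVr (G := img_group K y)) (imset_f _ Kb).
Qed.

Lemma card_img_sub (K : {group B}) x y :
  (#|img K (x - y)%R| <= #|img K x| * #|img K y|)%N.
Proof. by rewrite -(img_opp K y) card_img_add. Qed.

Definition small (H : {set A}) (K : {set B}) n := [set a in H | #|img K a| <= n]%N.

Lemma small_mono H K m n : (m <= n)%N -> small H K m \subset small H K n.
Proof.
by move=> mn; apply/subsetP => a; rewrite !inE => /andP[-> /leq_trans->].
Qed.

Definition gap_step (F : nat -> nat) n := maxn (F n) (n ^ 3)%N.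
(** Each of the m + 1 translates in [small_stable] uses two consecutive thresholds, so the indices
    run from 0 to 2m + 1. *)
Definition gap_bound F m := iter m.*2.+1 (gap_step F) m.

Lemma leq_gap_step F n : (0 < n)%N -> (n <= gap_step F n)%N.
Proof. by move=> n0; rewrite leq_max -{3}[n]expn1 leq_pexp2l ?orbT. Qed.

Lemma iter_gap_step F m i j : (0 < m)%N -> (i <= j)%N ->
  (m <= iter i (gap_step F) m <= iter j (gap_step F) m)%N.
Proof.
move=> m0; have mi k : (m <= iter k (gap_step F) m)%N.
  elim: k => //= k IH; apply: (leq_trans IH).
  by apply: leq_gap_step; apply: leq_trans IH.
move=> /subnKC <-; rewrite mi /=; elim: (j - i)%N => [|k IH]; first by rewrite addn0.
rewrite addnS /=; apply: (leq_trans IH); apply: leq_gap_step.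
exact: leq_trans m0 (mi _).
Qed.

(* If no two consecutive thresholds k_i < k_(i+1) = gap_step F k_i agreed, then
   picking z_i in small k_(2i+1) but not in small k_(2i) would give m + 1
   pairwise disjoint translates z_i + small m inside H. *)
Lemma small_stable F (H : {group A}) (K : {group B}) m :
    (0 < m)%N -> (#|H| <= m * #|small H K m|)%N ->
  exists n, [/\ (0 < n)%N, (n <= gap_bound F m)%N
              & small H K (gap_step F n) = small H K n].
Proof.
move=> m0 dense; pose k i := iter i (gap_step F) m.
have kle i j (ij : (i <= j)%N) : (m <= k i)%N /\ (k i <= k j)%N.
  by apply/andP; exact: iter_gap_step.
have [[i ib eqi]|noteq] :=
    pselect (exists2 i, (i < m.*2.+2)%N & small H K (k i.+1) = small H K (k i)).
  exists (k i); split=> //; last exact: (kle i m.*2.+1 ib).2.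
  exact: leq_trans m0 (kle i i (leqnn _)).1.
have zP (i : 'I_m.+1) : exists z, z \in small H K (k i.*2.+1) :\: small H K (k i.*2).
  apply/set0Pn; rewrite setD_eq0; apply/negP => sub; apply: noteq; exists i.*2.
    by rewrite ltnS (leq_trans (n := m.*2)) // leq_double -ltnS.
  by apply/eqP; rewrite eqEsubset sub small_mono ?(kle _ _ (leqnSn _)).2.
pose z i := xchoose (zP i).
have zin i : [/\ z i \in H, (#|img K (z i)| <= k i.*2.+1)%N
               & (k i.*2 < #|img K (z i)|)%N].
  have := xchooseP (zP i); rewrite -/(z i) !inE => /andP[+ /andP[zH ->]].
  by rewrite zH -ltnNge.
pose f (p : 'I_m.+1 * A) := z p.1 + p.2.
pose S := setX [set: 'I_m.+1] (small H K m).
(* A collision gives [z j = z i + s - t], whose image has size at most the cube of threshold 2i + 1,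
   hence at most threshold 2i + 2 <= 2j, against the choice of [z j]. *)
have no_collision (i j : 'I_m.+1) s t : (i < j)%N ->
    s \in small H K m -> t \in small H K m -> z i + s <> z j + t.
  move=> ij; rewrite !inE => /andP[_ sm] /andP[_ tm] e.
  have [_ _] := zin j; rewrite ltnNge => /negP; apply.
  have -> : z j = (z i + s) - t by rewrite e addrK.
  have [_ zi _] := zin i; have [mk _] := kle i.*2.+1 _ (leqnn _).
  apply: leq_trans (card_img_sub _ _ _) _.
  apply: (leq_trans (n := k i.*2.+1 ^ 3)).
    rewrite !expnS expn0 muln1 mulnA; apply: leq_mul; last exact: leq_trans mk.
    apply: leq_trans (card_img_add _ _ _) _.
    by apply: leq_mul => //; exact: leq_trans mk.
  apply: (leq_trans (n := k i.*2.+2)); first by rewrite /k iterS leq_maxr.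
  by apply: (kle _ _ _).2; rewrite -doubleS leq_double.
have finj : {in S &, injective f}.
  move=> [i s] [j t]; rewrite !in_setX /= !in_setT /= => sS tS e.
  have [ij|ji|ij] := ltngtP i j.
  - by case: (no_collision i j s t ij sS tS e).
  - by case: (no_collision j i t s ji tS sS (esym e)).
  - by move: e; rewrite /f /= (ord_inj ij) => /addrI ->.
have : (#|S| <= #|H|)%N.
  rewrite -(card_in_imset finj); apply: subset_leq_card; apply/subsetP.
  move=> _ /imsetP[[i s] /setXP[_ /= sS] ->].
  have [zH _ _] := zin i; apply: groupM => //.
  by move: sS; rewrite inE => /andP[].
(* The bounds (m + 1)|small m| <= |H| <= m|small m| would make [small H K m] empty, yet it contains
   0. *)
rewrite cardsX cardsT card_ord => /leq_trans /(_ dense).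
rewrite leq_mul2r ltnn orbF => /eqP/cards0_eq/setP/(_ 0).
by rewrite !inE group1 img0 cards1 m0.
Qed.

(** At a stable threshold [n], [small H K n] is itself the subgroup: a sum of two members has image
    of size at most n^2 <= [gap_step F n], and stability brings this back to [n]. *)
Lemma small_gap F (H : {group A}) (K : {group B}) m :
    (0 < m)%N -> (#|H| <= m * #|small H K m|)%N ->
  exists n (G : {group A}), [/\ (n <= gap_bound F m)%N, G \subset H,
      {in G, forall a, #|img K a| <= n}%N
    & {in H :\: G, forall a, F n < #|img K a|}%N].
Proof.
move=> m0 dense; have [n [n0 nb stab]] := small_stable F m0 dense.
have gS : group_set (small H K n).
  apply/group_setP; split; first by rewrite inE group1 img0 cards1.
  move=> x y; rewrite -{3}stab !inE => /andP[Hx xn] /andP[Hy yn].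
  rewrite groupM //=; apply: leq_trans (card_img_add _ _ _) _.
  rewrite (leq_trans (leq_mul xn yn)) // (leq_trans _ (leq_maxr _ _)) //.
  by rewrite !expnS expn0 muln1 leq_mul2l leq_pmulr ?orbT.
exists n, (Group gS); split=> //=.
- by apply/subsetP => a; rewrite inE => /andP[].
- by move=> a; rewrite inE => /andP[].
- move=> a; rewrite inE -stab inE => /andP[+ Ha]; rewrite Ha /= -ltnNge.
  by apply: leq_ltn_trans; apply: leq_maxl.
Qed.

End ImageSubgroups.

(** * Bilinear maps with bounded images in both variables *)

Lemma biadditive_flip (A B C : zmodType) (phi : A -> B -> C) :
  biadditive phi -> biadditive (fun b a => phi a b).
Proof. by case. Qed.

Lemma leq_card_bigcup (I T : finType) (X : {set I}) (F : I -> {set T}) :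
  (#|\bigcup_(i in X) F i| <= \sum_(i in X) #|F i|)%N.
Proof.
apply: (big_ind2 (fun (Y : {set T}) n => #|Y| <= n)%N) => //.
  by rewrite cards0.
move=> Y m Z n Ym Zn; rewrite cardsU (leq_trans (leq_subr _ _)) //.
exact: leq_add.
Qed.

Section BoundedImages.

Variables (A B C : finZmodType) (phi : A -> B -> C).
Hypothesis phiB : biadditive phi.
Variables (H : {group A}) (K : {group B}) (k l : nat).
Hypothesis imgK : {in H, forall a, #|img phi K a| <= k}%N.
Hypothesis imgH : {in K, forall b, #|img (fun b a => phi a b) H b| <= l}%N.

Let phiBl x y b : phi (x - y) b = phi x b - phi y b.
Proof. by have [/(_ b x y)] := phiB. Qed.

Let phiDl x y b : phi (x + y) b = phi x b + phi y b.
Proof. by apply/eqP; rewrite -subr_eq -phiBl addrK. Qed.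

Lemma l_gt0 : (0 < l)%N.
Proof.
apply: leq_trans (imgH (group1 K)).
exact: (card_img_gt0 (biadditive_flip phiB) H).
Qed.

(* With [a0] maximising [#|img phi K a0|] and [g] a section of [phi a0] over its
   image D0, any a - a' killed by all the [g c] satisfies img (a0 + a - a') = D0,
   so that [phi a] and [phi a'] agree modulo D0. *)
Lemma card_values :
  (#|[set phi a b | a in H, b in K]| <= l ^ k * (k * k))%N.
Proof.
have [a0 Ha0 maxa0] :
    exists2 a0, a0 \in H & {in H, forall a, #|img phi K a| <= #|img phi K a0|}%N.
  by case: (arg_maxnP (fun a => #|img phi K a|) (group1 H)) => a0; exists a0.
pose D0 := img_group phiB K a0.
pose g c := odflt 0 [pick b in K | phi a0 b == c].
have gP c : c \in D0 -> g c \in K /\ phi a0 (g c) = c.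
  move=> /imsetP[b Kb ->]; rewrite /g; case: pickP => /= [x /andP[Kx /eqP] //|].
  by move=> /(_ b); rewrite Kb eqxx.
(* The value 0 outside [D0] puts [tau a] in a [pfamily] whose cardinality is a product over [D0]
   alone. *)
pose tau a := [ffun c => if c \in D0 then phi a (g c) else 0].
have tauP a a' : a \in H -> a' \in H -> tau a = tau a' ->
    img phi K a \subset (img phi K a' * D0)%g.
  move=> Ha Ha' e; have Hh : a - a' \in H by rewrite groupM ?groupV.
  have imgE : img phi K (a0 + (a - a')) = D0.
    apply/esym/eqP; rewrite eqEcard; apply/andP; split; last first.
      by apply: maxa0; apply: groupM.
    apply/subsetP => c D0c; have [Kg gc] := gP _ D0c.
    apply/imsetP; exists (g c) => //; rewrite phiDl phiBl gc.
    by move/ffunP/(_ c): e; rewrite !ffunE D0c => ->; rewrite subrr addr0.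
  apply/subsetP => _ /imsetP[b Kb ->].
  have -> : phi a b = phi a' b + (phi (a0 + (a - a')) b - phi a0 b).
    by rewrite phiDl addrAC subrr add0r phiBl addrC subrK.
  apply: (@mem_mulg C); first exact: imset_f.
  apply: groupM; first by rewrite -imgE imset_f.
  by rewrite groupV; apply: imset_f.
pose T := tau @: H.
pose r t := odflt 0 [pick a in H | tau a == t].
have rP a : a \in H -> r (tau a) \in H /\ tau (r (tau a)) = tau a.
  move=> Ha; rewrite /r; case: pickP => /= [x /andP[Hx /eqP] //|].
  by move=> /(_ a); rewrite Ha eqxx.
have cardT : (#|T| <= l ^ k)%N.
  pose F c := img (fun b a => phi a b) H (g c).
  have sTF : T \subset pfamily 0 D0 F.
    apply/subsetP => _ /imsetP[a Ha ->]; apply/pfamilyP; split.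
      by apply/subsetP => c; rewrite inE ffunE; case: ifP => //; rewrite eqxx.
    by move=> c D0c; rewrite ffunE D0c; apply: imset_f.
  apply: leq_trans (subset_leq_card sTF) _; rewrite card_pfamily foldrE big_image.
  apply: (leq_trans (n := \prod_(c in D0) l)%N).
    by apply: leq_prod => c /gP[Kg _]; apply: imgH.
  by rewrite prod_nat_const leq_pexp2l ?l_gt0 ?imgK.
pose V t := (img phi K (r t) * D0)%g.
have sub : [set phi a b | a in H, b in K] \subset \bigcup_(t in T) V t.
  apply/subsetP => _ /imset2P[a b Ha Kb ->]; apply/bigcupP; exists (tau a).
    exact: imset_f.
  have [Hr e] := rP a Ha.
  by apply: (subsetP (tauP _ _ Ha Hr (esym e))); apply: imset_f.
apply: leq_trans (subset_leq_card sub) _; apply: leq_trans (leq_card_bigcup _ _) _.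
apply: (leq_trans (n := \sum_(t in T) k * k)%N).
  apply: leq_sum => _ /imsetP[a /rP[Hr _] ->].
  by apply: leq_trans (card_mulg_le _ _) _; rewrite leq_mul ?imgK.
by rewrite sum_nat_const leq_mul2r cardT orbT.
Qed.

Definition into (E : {set C}) : {set A} := [set a in H | img phi K a \subset E].

Lemma into_group_set (E : {group C}) : group_set (into E).
Proof.
apply/group_setP; split.
  by rewrite inE group1 (img0 phiB K) sub1G.
move=> x y; rewrite !inE => /andP[Hx xE] /andP[Hy yE]; rewrite groupM //=.
exact: subset_trans (img_add_sub phiB K x y) (mul_subG xE yE).
Qed.

Definition into_group E := Group (into_group_set E).

(* An upper bound for the number of distinct sets phi(a,K), a in H. *)
Definition pieces := (2 ^ (l ^ k * (k * k)))%N.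

Definition bad (D : {set C}) := [set a in H | ~~ (D \subset img phi K a)].

(** Pigeonhole: the bad elements have at most [pieces] distinct images, so some image E is shared by
    many of them, and all of these lie in [into E]. *)
Lemma dense_image (D : {set C}) f : (#|H| < f * #|bad D|)%N ->
  exists2 a, a \in bad D & (#|H| <= pieces * f * #|into (img phi K a)|)%N.
Proof.
move=> many; have [[a ba le]|none] :=
  pselect (exists2 a, a \in bad D & (#|H| <= pieces * f * #|into (img phi K a)|)%N).
  by exists a.
have badE : #|bad D| = (\sum_(E in img phi K @: bad D)
    #|[set a in bad D | img phi K a == E]|)%N.
  rewrite -sum1_card (partition_big_imset (img phi K)).
  by apply: eq_bigr => E _; rewrite -sum1dep_card.
have cardI : (#|img phi K @: bad D| <= pieces)%N.
  pose I := [set phi a b | a in H, b in K].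
  apply: (leq_trans (n := #|powerset I|)); last first.
    by rewrite card_powerset leq_pexp2l // card_values.
  apply: subset_leq_card; apply/subsetP => _ /imsetP[a + ->].
  rewrite !inE => /andP[Ha _]; apply/subsetP => _ /imsetP[b Kb ->].
  exact: imset2_f.
have p0 : (0 < pieces)%N by rewrite expn_gt0.
have : (pieces * (f * #|bad D|) <= pieces * #|H|)%N.
  rewrite mulnA badE big_distrr /=.
  apply: (leq_trans (n := \sum_(E in img phi K @: bad D) #|H|)%N).
    apply: leq_sum => _ /imsetP[a ba ->].
    rewrite leqNgt; apply/negP => lt; apply: none; exists a => //.
    apply: leq_trans (ltnW lt) _; rewrite leq_mul2l subset_leq_card ?orbT //.
    apply/subsetP => x; rewrite !inE => /andP[/andP[-> _] /eqP ->] /=.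
    exact: subxx.
  by rewrite sum_nat_const leq_mul2r cardI orbT.
by rewrite leq_pmul2l // leqNgt many.
Qed.

Fixpoint descent_bound (F : nat -> nat) s t :=
  if s is s'.+1 then maxn t (descent_bound F s' (t * (pieces * F t))) else t.

(* If D is not good enough, it is replaced by its intersection with a popular
   image not containing it.  The bound [s] is on these intersections rather than
   on D itself, so that the descent can start from D = C. *)
Lemma descent F s t (D : {group C}) : (0 < t)%N -> (#|H| <= t * #|into D|)%N ->
    {in bad D, forall a, #|D :&: img phi K a| < s}%N ->
  exists t' (E : {group C}), [/\ (0 < t')%N, (t' <= descent_bound F s t)%N,
    (#|H| <= t' * #|into E|)%N & (F t' * #|bad E| <= #|H|)%N].
Proof.
elim: s t D => [|s IH] t D t0 big lts.
  exists t, D; split=> //; suff -> : bad D = set0 by rewrite cards0 muln0.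
  by apply/setP => a; rewrite in_set0; apply/negP => /lts.
have [good|many] := leqP (F t * #|bad D|)%N #|H|.
  by exists t, D; split=> //=; rewrite leq_maxl.
have [a ba ale] := dense_image many.
have Ft0 : (0 < pieces * F t)%N.
  rewrite muln_gt0 expn_gt0 /=; case: (F t) many => //.
have := ba; rewrite inE => /andP[Ha Da].
pose E := img_group phiB K a; pose D' := (D :&: E)%G.
have intoE : into D' = into D :&: into E.
  by apply/setP => x; rewrite !inE subsetI; case: (x \in H).
case: (IH (t * (pieces * F t))%N D') => [||x xb|t' [E' [t'0 t'b H1 H2]]].
- by rewrite muln_gt0 t0.
(* Indices in [H] are submultiplicative under intersection, because the product of the two subgroups
   stays inside [H]. *)
- have : (#|into_group D * into_group E|%g <= #|H|)%N.
    apply: subset_leq_card; apply: mul_subG; apply/subsetP => x.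
      by rewrite inE => /andP[].
    by rewrite inE => /andP[].
  move=> cle; rewrite -(leq_pmul2l (cardG_gt0 H)).
  apply: leq_trans (leq_mul big ale) _; rewrite mulnACA.
  rewrite (mul_cardG (into_group D) (into_group E)) /= -intoE.
  by rewrite [leqRHS]mulnCA leq_mul2l leq_mul2r cle !orbT.
(* As [a] was bad for [D], [D'] has at most [s] elements; as [x] is bad for [D'], intersecting with
   its image loses at least one more. *)
- have := xb; rewrite inE => /andP[_ D'x].
  have le1 : (#|D'| <= s)%N by rewrite -ltnS; apply: lts.
  apply: leq_trans le1; rewrite proper_card // properE subsetIl /=.
  by apply: contra D'x; rewrite subsetI => /andP[].
- by exists t', E'; split=> //=; rewrite leq_max t'b orbT.
Qed.

(** The descent starts from the whole of [C]: its [into] is [H], whence 1, and the intersections are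
    the images themselves, of size at most [k], whence [k.+1]. *)
Definition structure_bound F := descent_bound F k.+1 1.

Lemma structure F :
  exists t (D : {group C}), [/\ (0 < t)%N, (t <= structure_bound F)%N,
    (#|H| <= t * #|into D|)%N & (F t * #|bad D| <= #|H|)%N].
Proof.
apply: (@descent F _ _ [group of setT]) => // [|a].
  rewrite mul1n subset_leq_card //; apply/subsetP => a Ha.
  by rewrite inE Ha subsetT.
by rewrite inE setTI ltnS => /andP[/imgK].
Qed.

End BoundedImages.

(** * Sums of unit fractions *)

Lemma egyptian_sum_set (R : realType) (I : finType) (X : {set I}) (n : I -> nat) :
  {in X, forall i, 0 < n i}%N ->
  egyptian_sum (\sum_(i in X) (n i)%:R^-1 : R) #|X|.
Proof.
move=> n0; exists (fun i => n (enum_val i)); split; first by move=> i; apply/n0/enum_valP.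
exact: (@big_enum_val R 0 +%R).
Qed.

Lemma egyptian_complexity_le (R : realType) (q : R) m :
  egyptian_sum q m -> exists2 k, egyptian_complexity q = Some k & (k <= m)%N.
Proof.
move=> qm; rewrite /egyptian_complexity; case: pselect => [ex|[]]; last first.
  by exists m; apply/asboolP.
case: ex_minnP => k _ kmin; exists k => //.
by apply/kmin/asboolP.
Qed.

(** By Lagrange, a coset of [G] on which [f] has the value v contributes |G||K| / (|A||B|v) = 1 /
    ([A:G][B:K]v), a unit fraction. *)
Lemma egyptian_coset_sum (R : realType) (A B : finZmodType) (G H : {group A})
    (K : {group B}) (f : A -> nat) :
  G \subset H -> {in H, forall x, 0 < f x}%N ->
  {in G & H, forall g x, f (g + x) = f x} ->
  egyptian_sum ((#|A| * #|B|)%:R^-1 * (#|K|%:R * \sum_(x in H) (f x)%:R^-1) : R)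
    #|H : G|%g.
Proof.
move=> sGH f0 fG.
have card0 (gT : finGroupType) (X : {group gT}) : #|X|%:R != 0 :> R.
  by rewrite pnatr_eq0 -lt0n cardG_gt0.
have lag (T : finZmodType) (X : {group T}) : #|T|%:R = #|X|%:R * #|setT : X|%g%:R :> R.
  by rewrite -natrM Lagrange ?subsetT // cardsT.
pose n (c : {set A}) := (#|setT : G|%g * #|setT : K|%g * f (repr c))%N.
have reprP x : x \in H -> exists2 g, g \in G & repr (G :* x)%g = g + x.
  by move=> Hx; have /rcosetP[g Gg ->] := mem_repr_rcoset G x; exists g.
have -> : (#|A| * #|B|)%:R^-1 * (#|K|%:R * \sum_(x in H) (f x)%:R^-1) =
    \sum_(c in rcosets G H) (n c)%:R^-1 :> R.
  rewrite (set_partition_big _ (rcosets_partition sGH)) /=.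
  rewrite !mulr_sumr; apply: eq_bigr => _ /rcosetsP[x Hx ->].
  have [g Gg rE] := reprP x Hx.
  have -> : \sum_(y in (G :* x)%g) (f y)%:R^-1 = #|G|%:R * (f x)%:R^-1 :> R.
    rewrite (eq_bigr (fun=> (f x)%:R^-1)) => [|_ /rcosetP[y Gy ->]].
      by rewrite sumr_const card_rcoset mulr_natl.
    by rewrite [f _]fG.
  rewrite /n rE fG // !natrM (lag A G) (lag B K).
  have idx0 (gT : finGroupType) (X Y : {group gT}) : #|X : Y|%g%:R != 0 :> R.
    by rewrite pnatr_eq0 -lt0n indexg_gt0.
  have fx0 : (f x)%:R != 0 :> R by rewrite pnatr_eq0 -lt0n f0.
  have := (card0 _ G, card0 _ K, idx0 _ [group of setT] G, idx0 _ [group of setT] K).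
  move=> [[[G0 K0] AG0] BK0]; field.
  by rewrite G0 K0 AG0 BK0 fx0.
have cG : #|H : G|%g = #|rcosets G H| by [].
rewrite cG; apply: egyptian_sum_set => _ /rcosetsP[x Hx ->].
rewrite /n !muln_gt0 !indexg_gt0 /=.
have [g Gg ->] := reprP x Hx; rewrite fG //; exact: f0.
Qed.

(** * Counting zeros through image sizes *)

Section ZeroCount.

Variables (R : realType) (A B C : finZmodType) (phi : A -> B -> C).
Hypothesis phiB : biadditive phi.

Lemma sum_zero_img (K : {group B}) a :
  \sum_(b in K) (phi a b == 0)%:R = #|K|%:R / #|img phi K a|%:R :> R.
Proof.
rewrite -(card_img_ker phiB K a) natrM mulrC mulKf; last first.
  by rewrite pnatr_eq0 -lt0n card_img_gt0.
rewrite -natr_sum; congr _%:R; rewrite -sum1dep_card big_mkcondr /=.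
by apply: eq_bigr => b _; case: eqP.
Qed.

Lemma sum_zero_le (X : {set A}) (K : {group B}) n : (0 < n)%N ->
    {in X, forall a, n < #|img phi K a|}%N ->
  \sum_(a in X) \sum_(b in K) (phi a b == 0)%:R <= #|X|%:R * #|K|%:R / n%:R :> R.
Proof.
move=> n0 big; rewrite -mulrA mulr_natl -sumr_const; apply: ler_sum => a Xa.
rewrite sum_zero_img ler_wpM2l // lef_pV2 ?posrE ?ltr0n ?card_img_gt0 //.
by rewrite ler_nat ltnW // big.
Qed.

(** An element of [small phi H K n] contributes at most |K|, any other at most |K|/n. *)
Lemma sum_zero_le_small (H : {group A}) (K : {group B}) n : (0 < n)%N ->
  \sum_(a in H) \sum_(b in K) (phi a b == 0)%:R <=
  #|small phi H K n|%:R * #|K|%:R + #|H|%:R * #|K|%:R / n%:R :> R.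
Proof.
move=> n0; rewrite (big_setID (small phi H K n)) /=; apply: lerD.
  have -> : H :&: small phi H K n = small phi H K n.
    by apply/setP => a; rewrite !inE andbA andbb.
  rewrite mulr_natl -sumr_const; apply: ler_sum => a _.
  rewrite sum_zero_img ler_piMr // invf_le1 ?ler1n ?ltr0n ?card_img_gt0 //.
apply: le_trans (sum_zero_le n0 _) _.
  by move=> a; rewrite !inE => /andP[+ Ha]; rewrite Ha /= -ltnNge.
rewrite -!mulrA ler_wpM2r // ?mulr_ge0 ?invr_ge0 //.
by rewrite ler_nat subset_leq_card // subsetDl.
Qed.

Lemma zero_probE : zero_prob R phi =
  (#|A| * #|B|)%:R^-1 * \sum_(a in [set: A]) \sum_(b in [set: B]) (phi a b == 0)%:R.
Proof.
rewrite /zero_prob mulrC; congr (_ * _).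
rewrite pair_big_dep /= -natr_sum; congr _%:R.
rewrite -sum1dep_card big_mkcond [RHS]big_mkcond /=.
by apply: eq_bigr => p _; rewrite !inE; case: eqP.
Qed.

End ZeroCount.

(** * Constants depending only on [eta] *)

Section Bounds.

Variables (R : realType) (eta : nat -> R).

(* In the names below, k bounds |phi(a,B)| on H and l bounds |phi(H,b)| on K; the
   gap used to find H must dominate the one later needed for every possible l. *)
Definition precision n := (Num.trunc (3 / eta n)).+1.
Definition modulus k l := structure_bound k l precision.
Definition gapB k l := precision (modulus k l).
Definition boundB k := gap_bound (gapB k) k.*2.
Definition gapA k := (\max_(l < (boundB k).+1) gapB k l)%N.
Definition boundA := gap_bound gapA (precision 0).
Definition complexity_bound :=
  (\max_(k < boundA.+1) \max_(l < (boundB k).+1) modulus k l)%N.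

Hypothesis eta_gt0 : forall n, 0 < eta n.

(** The 3 allots a third of [eta] to each of three errors: [a] outside H, [b] outside K, and bad
    [a]. *)
Lemma inv_precision_le m n : (precision m <= n)%N -> n%:R^-1 <= eta m / 3.
Proof.
move=> le; have t0 : 0 < 3 / eta m by rewrite divr_gt0.
have lt : 3 / eta m < n%:R.
  by apply: lt_le_trans (truncnS_gt _) _; rewrite ler_nat.
by rewrite -[eta m / 3]invf_div lef_pV2 ?posrE ?t0 ?(lt_trans t0 lt) ?ltW.
Qed.

Lemma gapB_le k l : (l <= boundB k)%N -> (gapB k l <= gapA k)%N.
Proof. by rewrite -ltnS => lb; apply: (leq_bigmax (Ordinal lb)). Qed.

Lemma modulus_le k l : (k <= boundA)%N -> (l <= boundB k)%N ->
  (modulus k l <= complexity_bound)%N.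
Proof.
rewrite -[(k <= _)%N]ltnS -[(l <= _)%N]ltnS => kb lb.
apply: leq_trans (leq_bigmax (Ordinal kb)).
exact: (leq_bigmax (Ordinal lb)).
Qed.

End Bounds.

(** * The contribution of H x K as an Egyptian sum plus an error *)

Section BoundedSum.

Variables (R : realType) (A B C : finZmodType) (phi : A -> B -> C).
Hypothesis phiB : biadditive phi.
Variables (H : {group A}) (K : {group B}).

(* |phi(a,K) + D| only depends on the coset of a modulo [into phi H K D], and it
   equals |phi(a,K)| unless a is bad. *)
Lemma coset_approximation (D : {group C}) :
  exists q eps : R, [/\ egyptian_sum q #|H : into_group phiB H K D|%g,
    (#|A| * #|B|)%:R^-1 * \sum_(a in H) \sum_(b in K) (phi a b == 0)%:R = q + eps
    & 0 <= eps <= (#|A| * #|B|)%:R^-1 * (#|K|%:R * #|bad phi H K D|%:R)].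
Proof.
pose f a := #|(img phi K a * D)%g|.
have imgf a : (#|img phi K a| <= f a)%N.
  by apply: subset_leq_card; apply: (mulG_subl D (img phi K a)).
have f_gt0 a : (0 < f a)%N by apply: leq_trans (imgf a); apply: card_img_gt0.
have sub x y : img phi K x \subset D -> (img phi K (x + y) * D \subset img phi K y * D)%g.
  move=> xD; apply: (subset_trans (mulSg _ (img_add_sub phiB K x y))).
  rewrite -(centC (A := img phi K y)) -?mulgA; last first.
    by apply/centsP => u _ v _; apply: (@addrC C).
  by rewrite mulgS // (mulSGid (H := img_group phiB K x)).
have fG : {in into_group phiB H K D & H, forall g x, f (g + x) = f x}.
  move=> g x Gg _; apply/eqP; rewrite eqn_leq !subset_leq_card //.
    rewrite -{1}[x](addKr g); apply: sub; rewrite (img_opp phiB).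
    by move: Gg; rewrite inE => /andP[].
  by apply: sub; move: Gg; rewrite inE => /andP[].
have sGH : into_group phiB H K D \subset H.
  by apply/subsetP => a; rewrite inE => /andP[].
have := @egyptian_coset_sum R A B _ H K f sGH (fun a _ => f_gt0 a) fG.
set q := (X in egyptian_sum X _) => qP.
pose gap a : R := #|img phi K a|%:R^-1 - (f a)%:R^-1.
exists q, ((#|A| * #|B|)%:R^-1 * (#|K|%:R * \sum_(a in H) gap a)).
have gap_ge0 a : 0 <= gap a.
  by rewrite subr_ge0 lef_pV2 ?posrE ?ltr0n ?f_gt0 ?card_img_gt0 // ler_nat.
split=> //.
  rewrite /q -!mulrDr -big_split /=; congr (_ * _).
  rewrite mulr_sumr; apply: eq_bigr => a _.
  by rewrite sum_zero_img // addrC subrK.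
apply/andP; split; first by rewrite !mulr_ge0 ?invr_ge0 // sumr_ge0.
apply: ler_wpM2l; first by rewrite invr_ge0.
apply: ler_wpM2l => //.
(* [gap a] is at most 1 on bad elements and vanishes on the others, whose image already absorbs
   [D]. *)
rewrite (big_setID (bad phi H K D)) /= -[X in _ <= X]addr0; apply: lerD.
  apply: (@le_trans _ _ (\sum_(a in bad phi H K D) 1)); last by rewrite sumr_const.
  have -> : H :&: bad phi H K D = bad phi H K D.
    by apply/setP => a; rewrite !inE andbA andbb.
  apply: ler_sum => a _; rewrite lerBlDr ler_wpDr ?invr_ge0 //.
  by rewrite invf_le1 ?ler1n ?ltr0n card_img_gt0.
rewrite big1 // => a; rewrite !inE => /andP[+ Ha].
rewrite Ha /= negbK => Da; rewrite /gap /f.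
by rewrite (mulGSid (G := img_group phiB K a)) ?subrr.
Qed.

End BoundedSum.

(** * Assembling the decomposition *)

Theorem theorem1p4 (R : realType) (eta : nat -> R)
    (eta01 : forall n, 0 < eta n < 1)
    (eta_decr : forall m n : nat, (m <= n)%N -> eta n <= eta m) :
  exists M : nat, forall (A B C : finZmodType) (phi : A -> B -> C),
    biadditive phi ->
    exists (q eps : R) (k : nat),
      [/\ zero_prob R phi = q + eps,
          0 <= q,
          egyptian_complexity q = Some k,
          (k <= M)%N
        & 0 <= eps <= eta k].
Proof.
have eta_gt0 n : 0 < eta n by case/andP: (eta01 n).
exists (complexity_bound eta) => A B C phi phiB.
have nz (T : finZmodType) (X : {group T}) : 0 < #|X|%:R :> R.
  by rewrite ltr0n cardG_gt0.
have A0 : 0 < #|A|%:R :> R by rewrite -cardsT (nz A [group of setT]).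
have B0 : 0 < #|B|%:R :> R by rewrite -cardsT (nz B [group of setT]).
pose AT := [group of [set: A]]; pose BT := [group of [set: B]].
set m := precision eta 0; have m0 : (0 < m)%N by [].
(* In the sparse case q = 0 has complexity 0, so the tolerance is [eta 0]; small and large images
   each contribute at most 1/m to the probability, hence at most a third of it. *)
have [dense|sparse] := leqP #|AT| (m * #|small phi AT BT m|)%N; last first.
  exists 0, (zero_prob R phi), 0%N; split=> //; first by rewrite add0r.
    apply/egyptian_complexityP; split=> //.
    by exists (fun=> 1%N); split=> //; rewrite big_ord0.
  apply/andP; split; first by rewrite /zero_prob divr_ge0.
  have im : m%:R^-1 <= eta 0%N / 3 by apply: inv_precision_le.
  have sm : #|small phi AT BT m|%:R <= #|A|%:R / m%:R :> R.
    rewrite ler_pdivlMr ?ltr0n // -natrM ler_nat mulnC -cardsT; exact: ltnW.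
  rewrite zero_probE mulrC ler_pdivrMr ?natrM ?mulr_gt0 //.
  apply: le_trans (sum_zero_le_small R phiB AT BT m0) _.
  rewrite /= !cardsT; have e0 := eta_gt0 0%N.
  have AB0 := mulr_gt0 A0 B0.
  have := ler_wpM2r (ltW B0) sm; have := ler_wpM2l (ltW AB0) im.
  have : 0 <= eta 0%N * (#|A|%:R * #|B|%:R) by rewrite mulr_ge0 ?(ltW e0) ?(ltW AB0).
  by rewrite [_ / _ * _]mulrAC; lra.
have [k [H [kb sHA imgH gapH]]] := small_gap phiB (gapA eta) m0 dense.
pose psi b a := phi a b; have psiB : biadditive psi := biadditive_flip phiB.
have k0 : (0 < k)%N.
  exact: leq_trans (card_img_gt0 phiB BT 0) (imgH _ (group1 H)).
pose zeros (X : {set A}) (Y : {set B}) : R :=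
  \sum_(a in X) \sum_(b in Y) (phi a b == 0)%:R.
have zerosC X Y : zeros X Y = \sum_(b in Y) \sum_(a in X) (psi b a == 0)%:R.
  exact: exchange_big.
have k20 : (0 < k.*2)%N by rewrite double_gt0.
(* On H x B the proportion of zeros is at least 1/k. Those [b] with more than 2k values on H account
   for at most 1/(2k), so the others have density at least 1/(2k). *)
have denseB : (#|BT| <= k.*2 * #|small psi BT H k.*2|)%N.
  have up := sum_zero_le_small R psiB BT H k20; rewrite -zerosC in up.
  have low : #|H|%:R * (#|BT|%:R / k%:R) <= zeros H BT.
    rewrite mulr_natl -sumr_const; apply: ler_sum => a Ha.
    rewrite sum_zero_img // ler_wpM2l // lef_pV2 ?posrE ?ltr0n ?card_img_gt0 //.
    by rewrite ler_nat imgH.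
  have := le_trans low up.
  rewrite [X in _ <= X + _]mulrC [X in _ <= _ + X]mulrAC [X in _ <= _ + X]mulrC.
  rewrite -mulrDr ler_pM2l // -lerBlDr => le.
  rewrite -(ler_nat R) natrM mulrC -ler_pdivrMr ?ltr0n //.
  apply: le_trans le; rewrite -mulrBr ler_wpM2l //.
  have kR : k%:R != 0 :> R by rewrite pnatr_eq0 -lt0n.
  have -> : k%:R^-1 = 2 * k.*2%:R^-1 :> R.
    by rewrite -muln2 natrM; field.
  by rewrite mulrDl mul1r addrK.
have [l [K [lb sKB imgK gapK]]] := small_gap psiB (gapB eta k) k20 denseB.
have imgHK : {in H, forall a, #|img phi K a| <= k}%N.
  by move=> a /imgH; apply: leq_trans; rewrite subset_leq_card // imsetS.
have [t [D [t0 tb dense_into few_bad]]] := structure phiB imgHK imgK (precision eta).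
have [q [err [qE zE /andP[err0 err1]]]] := @coset_approximation R _ _ _ _ phiB H K D.
have [c cE cb] := egyptian_complexity_le qE.
(* Each error is compared with [eta t]; since [c <= t] and [eta] decreases, this is relaxed to
   [eta c] only at the end. *)
have ct : (c <= t)%N.
  apply: leq_trans cb _; rewrite -(leq_pmul2l (cardG_gt0 (into_group phiB H K D))).
  rewrite Lagrange; first by rewrite mulnC.
  by apply/subsetP => a; rewrite inE => /andP[].
have tM : (t <= modulus eta k l)%N by [].
pose N : R := (#|A| * #|B|)%:R^-1.
have N0 : 0 <= N by rewrite invr_ge0.
pose S1 := zeros (AT :\: H) BT; pose S2 := zeros H (BT :\: K).
have zeros_ge0 X Y : 0 <= zeros X Y by apply: sumr_ge0 => a _; apply: sumr_ge0.
have split_zeros : zeros AT BT = S1 + S2 + zeros H K.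
  rewrite /S1 /zeros (big_setID H) /= setTI addrC -addrA; congr (_ + _).
  rewrite -big_split; apply: eq_bigr => a _.
  by rewrite (big_setID K) /= setTI addrC.
have subR (T : finZmodType) (X : {set T}) : #|X|%:R <= #|T|%:R :> R.
  by rewrite ler_nat max_card.
(* Both gaps were fixed before [t] was known, so they are calibrated at [modulus eta k l], an upper
   bound for [t]. *)
have eta_t u : (precision eta (modulus eta k l) <= u)%N -> u%:R^-1 <= eta t / 3.
  move=> /(inv_precision_le eta_gt0) /le_trans; apply.
  by rewrite ler_wpM2r ?invr_ge0 // eta_decr.
have NAB x y z : 0 <= x <= #|A|%:R -> 0 <= y <= #|B|%:R -> 0 <= z ->
    N * (x * y * z) <= z.
  move=> /andP[x0 xA] /andP[y0 yB] z0.
  rewrite /N natrM mulrC ler_pdivrMr ?mulr_gt0 // [leRHS]mulrC ler_wpM2r //.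
  exact: ler_pM.
have b1 : N * S1 <= eta t / 3.
  have Lb : (gapB eta k l <= gapA eta k)%N by apply: gapB_le.
  apply: le_trans (eta_t _ Lb).
  have L0 : (0 < gapA eta k)%N by apply: leq_trans Lb.
  apply: le_trans (ler_wpM2l N0 (sum_zero_le R phiB (K := BT) L0 gapH)) _.
  apply: NAB.
  - by rewrite ler0n subR.
  - by rewrite ler0n subR.
  - by rewrite invr_ge0.
have b2 : N * S2 <= eta t / 3.
  apply: le_trans (eta_t _ (leqnn _)).
  have L0 : (0 < gapB eta k l)%N by [].
  rewrite /S2 zerosC.
  apply: le_trans (ler_wpM2l N0 (sum_zero_le R psiB (K := H) L0 gapK)) _.
  rewrite [X in N * (X / _)]mulrC; apply: NAB.
  - by rewrite ler0n subR.
  - by rewrite ler0n subR.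
  - by rewrite invr_ge0.
have b3 : err <= eta t / 3.
  apply: le_trans err1 _.
  apply: le_trans (inv_precision_le eta_gt0 (leqnn _)).
  have few : #|K|%:R * #|bad phi H K D|%:R
      <= #|H|%:R * #|K|%:R / (precision eta t)%:R :> R.
    rewrite mulrAC [leRHS]mulrC ler_wpM2l // ler_pdivlMr // -natrM ler_nat.
    by rewrite mulnC.
  apply: le_trans (ler_wpM2l N0 few) _; apply: NAB.
  - by rewrite ler0n subR.
  - by rewrite ler0n subR.
  - by rewrite invr_ge0.
exists q, (zero_prob R phi - q), c; split=> //.
- by rewrite addrC subrK.
- by case: qE => n [_ ->]; apply: sumr_ge0 => i _; rewrite invr_ge0.
- apply: leq_trans ct (leq_trans tM _); exact: modulus_le.
have -> : zero_prob R phi - q = N * S1 + N * S2 + err.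
  rewrite zero_probE -/(zeros AT BT) split_zeros mulrDr zE -/N mulrDr.
  by rewrite [q + err]addrC addrA addrK.
apply/andP; split; first by rewrite !addr_ge0 // mulr_ge0 // zeros_ge0.
by apply: le_trans (eta_decr _ _ ct); lra.
Qed.
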